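(* Let $k$ and $l$ be fixed positive integers. Then: (i) For $l\ge 2$ there exists a constant $c$ (depending only on $k$ and $l$) such that for every integer $n\ge 2k+1$, $$\mathrm{ex}(J(n;k,k+1),C_{4l})\le \Big(c\,(n-k)^{-\frac12+\frac{1}{2l}}+\frac{1}{\sqrt{k+1}}\Big)\,e(J(n;k,k+1)).$$ (ii) For $l\ge 1$ there is a function $f(n)=f_{k,l}(n)$ with $\lim_{n\to\infty}f(n)=0$ such that for every integer $n\ge 2k+1$, $$\mathrm{ex}(J(n;k,k+1),C_{4l+2})\le \Big(\frac{1}{2(k+1)}+\frac{\sqrt2}{2}+f(n)\Big)\,e(J(n;k,k+1)).$$
   Context: For positive integers $n\ge k+1$, the doubled Johnson graph $J(n;k,k+1)$ is the bipartite graph with vertex set $\binom{[n]}{k}\cup\binom{[n]}{k+1}$ (all $k$-subsets and $(k+1)$-subsets of $[n]=\{1,\dots,n\}$), where two vertices $u,v$ are adjacent iff $u\subset v$ or $v\subset u$. It has $e(J(n;k,k+1))=(n-k)\binom{n}{k}=(k+1)\binom{n}{k+1}$ edges. $C_m$ denotes the cycle of length $m$. For graphs $G,H$, the generalized Turán number $\mathrm{ex}(G,H)$ is the maximum number of edges of a subgraph of $G$ containing no subgraph isomorphic to $H$. *)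

(* Defs.v *)
From mathcomp Require Import all_boot.
Set Implicit Arguments. Unset Strict Implicit. Unset Printing Implicit Defensive.

(* Vertices of J(n;k,k+1): subsets of [n] = 'I_n (of size k or k+1).
   An edge is stored as an ordered pair (A, B) with #|A| = k, #|B| = k+1,
   A \subset B (A the k-set, B the (k+1)-set). *)
Definition Jedges (n k : nat) : {set {set 'I_n} * {set 'I_n}} :=
  [set p : {set 'I_n} * {set 'I_n} | [&& #|p.1| == k, #|p.2| == k.+1 & p.1 \subset p.2]].

Definition eJ (n k : nat) : nat := #|Jedges n k|.

Definition adjb n (F : {set {set 'I_n} * {set 'I_n}}) (u v : {set 'I_n}) : bool :=
  ((u, v) \in F) || ((v, u) \in F).

Definition has_cycle n (F : {set {set 'I_n} * {set 'I_n}}) (m : nat) : bool :=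
  [exists v : {ffun 'I_m -> {set 'I_n}},
     injectiveb v && [forall i : 'I_m, adjb F (v i) (v (ordS i))]].

Definition exJ (n k m : nat) : nat :=
  \max_(F : {set {set 'I_n} * {set 'I_n}} | (F \subset Jedges n k) && ~~ has_cycle F m)
     #|F|.

(* Main.v *)
Require Import Defs.
From mathcomp Require Import all_boot zify.
From Stdlib Require Import Reals Lra.
(* Reals rebinds [^] in nat_scope. *)
From mathcomp Require Import ssrnat.
Set Implicit Arguments. Unset Strict Implicit. Unset Printing Implicit Defensive.

(** For a [(k-1)]-set [T], let [G_T] be the graph on the points outside [T] in
    which [a ~ b] iff both [T+a] and [T+b] are joined to [T+a+b] in [F].  An
    [m]-cycle of [G_T] yields a [2m]-cycle of [F].  If [d(S)] is the degree in
    [F] of a [(k+1)]-set [S], then [sum_S d(S) (d(S) - 1)] is the number of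
    ordered edges of all the [G_T], so with [N = C(n, k+1)] and [G_T] of density
    at most [p], Cauchy-Schwarz gives [|F|^2 <= N |F| + p k (k+1) N^2].

    This is enough room to use only soft bounds on [p] for [n] large: a dense
    graph contains [K_{l,l}], hence [C_{2l}], and a graph of density above [1/2]
    contains every odd cycle [C_{2l+1}].  Solving the quadratic inequality gives
    the constants [1 / sqrt (k+1)] and [1 / (2(k+1)) + sqrt 2 / 2] with no error
    term for [n >= n0]; the error terms only absorb the finitely many [n < n0]. *)

(** * Double counting and Cauchy-Schwarz *)

Lemma card_setX_sum1 (A B : finType) (W : {set A * B}) :
  #|W| = \sum_a #|[set b | (a, b) \in W]|.
Proof.
rewrite -sum1_card (eq_bigl (fun p => predT p.1 && ((p.1, p.2) \in W))); last by case.
rewrite -(pair_big_dep predT (fun a b => (a, b) \in W) (fun _ _ => 1)) /=.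
by apply: eq_bigr => a _; rewrite -sum1_card; apply: eq_bigl => b; rewrite inE.
Qed.

Lemma card_setX_sum2 (A B : finType) (W : {set A * B}) :
  #|W| = \sum_b #|[set a | (a, b) \in W]|.
Proof.
rewrite card_setX_sum1.
under eq_bigr do rewrite -sum1_card big_mkcond.
rewrite exchange_big /=; apply: eq_bigr => b _.
by rewrite -sum1_card [RHS]big_mkcond; apply: eq_bigr => a _; rewrite !inE.
Qed.

Lemma sqr_sum_leq (I : finType) (P : {set I}) (d : I -> nat) :
  (\sum_(i in P) d i) ^ 2 <= #|P| * \sum_(i in P) d i ^ 2.
Proof.
rewrite -(leq_pmul2l (isT : 0 < 2)) -mulnn big_distrlr /= big_distrr /=.
have -> : 2 * (#|P| * \sum_(i in P) d i ^ 2)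
    = \sum_(i in P) \sum_(j in P) (d i ^ 2 + d j ^ 2).
  under [RHS]eq_bigr do rewrite big_split /= sum_nat_const.
  by rewrite big_split /= sum_nat_const -big_distrr /= mul2n addnn.
apply: leq_sum => i _; rewrite big_distrr /=.
by apply: leq_sum => j _; rewrite nat_Cauchy.
Qed.

(** * Cycles in dense graphs *)

Definition graph_cycle (V : Type) (e : rel V) (m : nat) : Prop :=
  exists2 a : nat -> V,
    (forall i j, i < m -> j < m -> a i = a j -> i = j) &
    (forall i, i < m -> e (a i) (a (i.+1 %% m))).

Section Graph.
Variables (V : finType) (e : rel V).
Hypotheses (e_sym : symmetric e) (e_irr : irreflexive e).

(** The cycle alternates between [A] and [B], which are disjoint because a common vertex would carry
    a loop. *)
Lemma biclique_cycle (l : nat) (A B : {set V}) :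
  0 < l -> l <= #|A| -> l <= #|B| -> {in A & B, forall x y, e x y} ->
  graph_cycle e (2 * l).
Proof.
move=> l_gt0 /card_geqP[s [s_uniq s_size sA]] /card_geqP[t [t_uniq t_size tB]] eAB.
have /hasP[x0 _ _] : has predT s by rewrite has_predT s_size.
have neqst u v : u \in s -> v \in t -> u <> v.
  by move=> us vt uv; have := eAB u v (sA _ us) (tB _ vt); rewrite uv e_irr.
have ns i : i < 2 * l -> nth x0 s i./2 \in s by move=> ?; apply: mem_nth; rewrite s_size; lia.
have nt i : i < 2 * l -> nth x0 t i./2 \in t by move=> ?; apply: mem_nth; rewrite t_size; lia.
exists (fun i => nth x0 (if odd i then t else s) i./2) => [i j il jl|i il].
  case oi: (odd i); case oj: (odd j) => E.
  - by move/eqP: E; rewrite nth_uniq ?s_size ?t_size //; [move/eqP; lia|lia|lia].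
  - by case: (neqst _ _ (ns j jl) (nt i il)).
  - by case: (neqst _ _ (ns i il) (nt j jl)).
  - by move/eqP: E; rewrite nth_uniq ?s_size ?t_size //; [move/eqP; lia|lia|lia].
have jl : i.+1 %% (2 * l) < 2 * l by rewrite ltn_pmod; lia.
have -> : odd (i.+1 %% (2 * l)) = ~~ odd i by rewrite odd_mod ?oddM.
by case: (odd i) => /=; [rewrite e_sym|]; apply: eAB; auto.
Qed.

Definition edges : {set V * V} := [set p | e p.1 p.2].
Definition nbr (x : V) : {set V} := [set y | e x y].

Lemma card_edges : #|edges| = \sum_x #|nbr x|.
Proof.
rewrite card_setX_sum1; apply: eq_bigr => x _.
by apply: eq_card => y; rewrite !inE.
Qed.

(** A soft Kovari-Sos-Turan argument: fix [M] vertices of large degree and apply the pigeonhole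
    principle to the traces of all neighbourhoods on them. *)
Lemma dense_even_cycle (l D : nat) : 0 < l -> 0 < D ->
  4 * D * l * (2 ^ (4 * D * l)).+1 <= #|V| ->
  #|V| ^ 2 < D * #|edges| -> graph_cycle e (2 * l).
Proof.
set M := 4 * D * l; set n := #|V| => l_gt0 D_gt0 n_big E_big.
have M_exp : M < 2 ^ M by exact: ltn_expl.
(* Vertices outside [X0] account for at most [n ^ 2 / (2 D)] ordered edges, less than half of them,
   so [X0] has more than [n / (2 D)] elements. *)
pose X0 := [set x | n <= 2 * D * #|nbr x|].
have X0_big : M <= #|X0|.
  have : 2 * D * #|edges| <= 2 * D * #|X0| * n + n * n.
    rewrite card_edges big_distrr /=.
    apply: (@leq_trans (\sum_x ((if x \in X0 then 2 * D * n else 0) + n))).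
      apply: leq_sum => x _; rewrite inE.
      have : #|nbr x| <= n by exact: max_card.
      by case: (leqP n) => /= ? ?; nia.
    by rewrite big_split /= sum_nat_const -big_mkcond sum_nat_const -/n; lia.
  have n_gt0 : 0 < n by nia.
  move=> H; have {H} : n * n < 2 * D * #|X0| * n by nia.
  rewrite ltn_pmul2r // => H.
  have : 4 * D * M <= n by nia.
  nia.
case/card_geqP: X0_big => s [s_uniq s_size sX0].
pose X : {set V} := [set x in s].
have cX : #|X| = M by rewrite cardsE (card_uniqP s_uniq).
pose phi y : {set V} := [set x in X | e x y].
pose Y := [set y | l <= #|phi y|].
(* By the choice of [M], the vertices of [X] have total degree at least [M n / (2 D) = 2 l n]; the
   vertices outside [Y] absorb at most [l n] of it. *)
have Y_big : l * n <= M * #|Y|.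
  have H1 : 2 * l * n <= \sum_(x in X) #|nbr x|.
    have : M * n <= 2 * D * \sum_(x in X) #|nbr x|.
      rewrite -cX -sum_nat_const big_distrr /=; apply: leq_sum => x.
      by rewrite inE => /sX0; rewrite inE.
    by rewrite /M; nia.
  have H2 : \sum_(x in X) #|nbr x| = \sum_y #|phi y|.
    under eq_bigr do rewrite -sum1_card big_mkcond.
    rewrite exchange_big /=; apply: eq_bigr => y _.
    rewrite -sum1_card big_mkcond [RHS]big_mkcond /=; apply: eq_bigr => x _.
    by rewrite !inE; case: (x \in s).
  have H3 : \sum_y #|phi y| <= l * n + M * #|Y|.
    apply: (@leq_trans (\sum_y (l + (if y \in Y then M else 0)))).
      apply: leq_sum => y _; rewrite inE.
      have : #|phi y| <= M.
        by rewrite -cX subset_leq_card //; apply/subsetP => x; rewrite inE => /andP[].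
      by case: (leqP l) => /=; lia.
    by rewrite big_split /= sum_nat_const -big_mkcond sum_nat_const -/n; lia.
  lia.
(* Only [2 ^ M] traces are possible, so some [Z] is shared by [l] vertices of [Y]; [Z] and this
   fibre form the biclique. *)
have [Z lZ] : exists Z : {set V}, l <= #|[set y in Y | phi y == Z]|.
  apply/existsP; apply: contraT; rewrite negb_exists => /forallP noZ.
  suff : #|Y| <= 2 ^ M * l by nia.
  rewrite -cX -card_powerset -sum_nat_const -sum1_card.
  rewrite (partition_big phi (mem (powerset X))) /=; last first.
    by move=> y _; rewrite powersetE; apply/subsetP => x; rewrite inE => /andP[].
  apply: leq_sum => Z _.
  rewrite sum1dep_card; move: (noZ Z); rewrite -ltnNge => /ltnW; apply: leq_trans.
  by apply: subset_leq_card; apply/subsetP => y; rewrite !inE.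
have [y yY] : exists y, y \in [set y in Y | phi y == Z].
  by apply/set0Pn; rewrite -card_gt0; lia.
apply: (@biclique_cycle l Z [set y in Y | phi y == Z]) => //.
  by move: yY; rewrite !inE => /andP[? /eqP <-].
move=> x z xZ; rewrite inE => /andP[_ /eqP zZ].
by move: xZ; rewrite -zZ inE => /andP[].
Qed.

Lemma codegree_cycle (m : nat) (U : {set V}) : 2 < m -> U != set0 ->
  {in U &, forall x y, m <= #|[set z in U | e x z & e z y]|} ->
  graph_cycle e m.
Proof.
move=> m_gt2 /set0Pn[x0 x0U] codeg.
have extend (s : seq V) x y : x \in U -> y \in U -> size s < m ->
    exists2 z, z \in U & [/\ z \notin s, e x z & e z y].
  move=> xU yU s_size.
  have : ~~ ([set z in U | e x z & e z y] \subset s).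
    apply/negP => /subset_leq_card; rewrite leqNgt => /negP; apply.
    by apply: leq_trans (codeg x y xU yU); apply: leq_ltn_trans (card_size s) _.
  case/subsetPn => z; rewrite inE => /andP[zU /andP[xz zy]] zs.
  by exists z.
have [p [p_size p_path p_uniq pU]] : exists p, [/\ size p = m - 2, path e x0 p,
    uniq (x0 :: p) & {subset x0 :: p <= U}].
  have : m - 2 <= m - 2 by [].
  elim: {1 3}(m - 2) => [_|q IH qm].
    by exists [::]; split => // x; rewrite inE => /eqP ->.
  have [p [p_size p_path p_uniq pU]] := IH (ltnW qm).
  have lU : last x0 p \in U by apply: pU; rewrite mem_last.
  (* With both endpoints equal, the codegree hypothesis serves as a degree bound. *)
  have [|z zU [zp xz _]] := extend (x0 :: p) _ _ lU lU; first by rewrite /=; lia.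
  exists (rcons p z); split.
  - by rewrite size_rcons p_size.
  - by rewrite rcons_path p_path.
  - by rewrite -rcons_cons rcons_uniq zp.
  - by move=> x; rewrite -rcons_cons mem_rcons inE => /predU1P[->|/pU].
have lU : last x0 p \in U by apply: pU; rewrite mem_last.
have [|z zU [zp xz zx]] := extend (x0 :: p) (last x0 p) x0 lU x0U.
  by rewrite /=; lia.
pose c := rcons (x0 :: p) z.
have c_size : size c = m by rewrite size_rcons /= p_size; lia.
have c_uniq : uniq c by rewrite rcons_uniq zp.
have c_path : path e x0 (rcons (rcons p z) x0).
  by rewrite rcons_path last_rcons rcons_path p_path xz zx.
exists (nth x0 c) => [i j im jm /eqP|i im].
  by rewrite nth_uniq ?c_size // => /eqP.
move/(pathP x0)/(_ i): c_path; rewrite size_rcons.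
have -> : (size (rcons p z)).+1 = m by rewrite -c_size.
move=> /(_ im); rewrite -[x0 :: _]/(rcons c x0) nth_rcons c_size im.
move: (im); rewrite leq_eqVlt => /predU1P[im'|im'].
  rewrite im' modnn nth_rcons size_rcons p_size.
  have -> : (i < (m - 2).+1) = false by lia.
  by have -> : (i == (m - 2).+1) = true by lia.
rewrite modn_small // nth_rcons size_rcons p_size.
by have -> : i < (m - 2).+1 by lia.
Qed.

Definition edges_in (U : {set V}) : {set V * V} :=
  [set p in edges | (p.1 \in U) && (p.2 \in U)].

(** Edges are ordered pairs, so each neighbour of [x] in [U] accounts for two of the lost ones. *)
Lemma card_edges_inD1 (U : {set V}) x : x \in U ->
  #|edges_in U| <= #|edges_in (U :\ x)| + 2 * #|nbr x :&: U|.
Proof.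
move=> xU; set N := nbr x :&: U.
have sub : edges_in U \subset
   edges_in (U :\ x) :|: ((pair x @: N) :|: ((fun y => (y, x)) @: N)).
  apply/subsetP => -[a b]; rewrite !inE /= => /and3P[eab aU bU].
  rewrite aU bU eab !andbT /=.
  have [ax|ax] := eqVneq a x; have [bx|bx] := eqVneq b x => //=.
  - by move: eab; rewrite ax bx e_irr.
  - by rewrite ax imset_f // !inE -ax eab bU.
  - rewrite bx [X in _ || X](_ : _ = true) ?orbT //; apply: imset_f.
    by rewrite !inE -bx e_sym eab aU.
apply: leq_trans (subset_leq_card sub) _.
apply: leq_trans (leq_card_setU _ _) _; rewrite leq_add2l.
apply: leq_trans (leq_card_setU _ _) _.
by rewrite mul2n -addnn; apply: leq_add; apply: leq_imset_card.
Qed.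

(* A set [U] maximising [4 D e(U) - (2 D + 1) |U|^2] induces a subgraph of
   minimum degree above [(1/2 + 1/(4 D)) (|U| - 1/2)], so any two of its
   vertices have linearly many common neighbours. *)
Lemma dense_cycle (m D : nat) : 2 < m -> 0 < D ->
  2 * D * (2 * D * m + D + 1) <= #|V| ->
  (D + 1) * #|V| ^ 2 < 2 * D * #|edges| -> graph_cycle e m.
Proof.
set n := #|V| => m_gt2 D_gt0 n_big E_big.
(* The shift by [(2 * D + 1) * n ^ 2] keeps the weight in [nat] without truncation. *)
pose w (U : {set V}) := 4 * D * #|edges_in U| + (2 * D + 1) * (n ^ 2 - #|U| ^ 2).
have [U _ Umax] := @arg_maxnP _ setT predT w isT.
have Un : #|U| <= n by exact: max_card.
(* Comparing [U] with the whole vertex set shows that the maximiser is not small. *)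
have U_big : n ^ 2 <= 2 * D * #|U| ^ 2.
  have := Umax setT isT; rewrite /w cardsT -/n subnn.
  have -> : edges_in setT = edges by apply/setP => p; rewrite !inE /= andbT.
  have EU : #|edges_in U| <= #|U| ^ 2.
    rewrite -mulnn -cardsX; apply: subset_leq_card; apply/subsetP => p.
    by rewrite !inE => /andP[].
  have /(leq_mul (leqnn (4 * D))) := EU.
  have /(leq_mul (leqnn (2 * D + 1))) : #|U| ^ 2 <= n ^ 2 by rewrite leq_sqr.
  rewrite /geq /= mulnBr; move: E_big.
  move: (#|U| ^ 2) (n ^ 2) #|edges_in U| #|edges| => u2 n2 EU' E'; lia.
have {U_big} U_big : 2 * D * m + D + 1 <= #|U|.
  rewrite leqNgt; apply/negP => H.
  have : 2 * D * #|U| < n by nia.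
  have : 2 * D * #|U| ^ 2 <= (2 * D * #|U|) ^ 2 by nia.
  move=> H1 H2; have : (2 * D * #|U|) ^ 2 < n ^ 2 by rewrite ltn_sqr.
  by rewrite ltnNge (leq_trans U_big).
have deg x : x \in U -> (2 * D + 1) * (2 * #|U| - 1) <= 8 * D * #|nbr x :&: U|.
  move=> xU; have := Umax (U :\ x) isT; have := card_edges_inD1 xU.
  rewrite /w /geq /= (cardsD1 x U) xU /=; set u := #|U :\ x|.
  have : u.+1 <= n by move: Un; rewrite (cardsD1 x U) xU.
  rewrite -leq_sqr => /(leq_mul (leqnn (2 * D + 1))) un.
  move=> /(leq_mul (leqnn (4 * D))) ed.
  have : (2 * D + 1) * u ^ 2 <= (2 * D + 1) * n ^ 2.
    by apply: leq_trans un; rewrite leq_mul // leq_sqr.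
  move: un; rewrite !mulnBr -addn1 sqrnD; lia.
apply: (@codegree_cycle m U) => //; first by rewrite -card_gt0; lia.
move=> x y xU yU.
have -> : [set z in U | e x z & e z y] = (nbr x :&: U) :&: (nbr y :&: U).
  by apply/setP => z; rewrite !inE (e_sym y); case: (z \in U); rewrite ?andbF ?andbT.
(* Adding the two degree bounds gives [8 D c >= 4 |U| - 4 D - 2], and the lower bound on [|U|] makes
   this exceed [8 D m]. *)
have := cardsUI (nbr x :&: U) (nbr y :&: U).
have : #|(nbr x :&: U) :|: (nbr y :&: U)| <= #|U|.
  by apply: subset_leq_card; rewrite subUset !subsetIr.
have := deg x xU; have := deg y yU; clear -U_big D_gt0.
set a := #|nbr x :&: U|; set b := #|nbr y :&: U|; set c := #|_ :&: _|.
move=> hb ha hU hUI; rewrite -(leq_pmul2l (_ : 0 < 8 * D)); last by lia.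
have : 8 * D * (a + b) <= 8 * D * (#|U| + c) by rewrite leq_mul2l; lia.
rewrite mulnBr in ha, hb; lia.
Qed.

End Graph.

(** * Link graphs *)

Section Link.
Variable n : nat.
Implicit Types (F : {set {set 'I_n} * {set 'I_n}}) (T S A B : {set 'I_n}).

(** The graph G_T, kept on all of ['I_n] with the points of [T] isolated, so that its order is [n]
    for every [T]. *)
Definition link F T : rel 'I_n := [rel a b |
  [&& a \notin T, b \notin T, a != b,
      (a |: T, a |: (b |: T)) \in F & (b |: T, a |: (b |: T)) \in F]].

Lemma link_sym F T : symmetric (link F T).
Proof.
move=> a b; rewrite /link /= setUCA (eq_sym b a).
by rewrite andbCA; do 3![congr (_ && _)]; rewrite andbC.
Qed.

Lemma link_irr F T : irreflexive (link F T).
Proof. by move=> a; rewrite /link /= eqxx !andbF. Qed.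

(** Insert [T + a_i + a_(i+1)] between [T + a_i] and [T + a_(i+1)]. Cardinality separates the two
    kinds of vertices. *)
Lemma link_cycle F T m : 2 < m -> graph_cycle (link F T) m -> has_cycle F (2 * m).
Proof.
move=> m_gt2 [a a_inj a_edge].
pose s i := i.+1 %% m.
have sm i : s i < m by rewrite ltn_pmod; lia.
have sE i : i < m -> s i = (if i.+1 == m then 0 else i.+1).
  by move=> im; rewrite /s; case: eqP => [->|?]; rewrite ?modnn // modn_small; lia.
have aT i : i < m -> a i \notin T by move=> /a_edge /and5P[].
pose v i := if odd i then a i./2 |: (a (s i./2) |: T) else a i./2 |: T.
have cv i : i < 2 * m -> #|v i| = odd i + #|T|.+1.
  move=> im; have hm : i./2 < m by lia.
  have /and5P[aiT ajT aij _ _] := a_edge _ hm.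
  by rewrite /v; case: (odd i); rewrite !cardsU1 ?in_setU1 ?negb_or ?aij ?aiT ?ajT.
have v_inj i j : i < 2 * m -> j < 2 * m -> v i = v j -> i = j.
  move=> im jm vij.
  have him : i./2 < m by lia.
  have hjm : j./2 < m by lia.
  have oij : odd i = odd j.
    by move: (cv i im) (cv j jm); rewrite vij => ->; case: (odd i); case: (odd j) => //=; lia.
  suff : i./2 = j./2 by lia.
  move: vij; rewrite /v -oij; case: (odd i) => /setP vij.
    (* Two cyclically consecutive pairs of indices coincide only if they start at the same index;
       this is where [2 < m] matters. *)
    have H u : u < m -> a u \notin T ->
        (u == i./2) || (u == s i./2) = ((u == j./2) || (u == s j./2)).
      move=> um uT; have := vij (a u); rewrite !inE (negPf uT) !orbF.
      have au w : w < m -> (a u == a w) = (u == w).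
        by move=> wm; apply/eqP/eqP => [|->] //; apply: a_inj.
      by rewrite !au.
    have := H _ him (aT _ him); have := H _ (sm i./2) (aT _ (sm _)).
    have := H _ hjm (aT _ hjm); rewrite !eqxx !orbT !sE //.
    by case: (i./2.+1 =P m) => ?; case: (j./2.+1 =P m) => ?; lia.
  have := vij (a i./2); rewrite !inE eqxx (negPf (aT _ him)) !orbF /= => /esym/eqP.
  exact: a_inj.
apply/existsP; exists [ffun i : 'I_(2 * m) => v i]; apply/andP; split.
  apply/injectiveP => i j; rewrite !ffunE => /v_inj H; apply: val_inj; exact: H.
apply/forallP => i; rewrite !ffunE /adjb /=.
have im := ltn_ord i.
have /and5P[_ _ _ e1 e2] : link F T (a i./2) (a (s i./2)) by apply: a_edge; lia.
have Si : i.+1 %% (2 * m) = if i.+1 == 2 * m then 0 else i.+1.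
  by case: eqP => [->|?]; rewrite ?modnn // modn_small; lia.
rewrite /v Si; case oi: (odd i).
  have -> : odd (if i.+1 == 2 * m then 0 else i.+1) = false by case: eqP => //=; rewrite oi.
  have -> : (if i.+1 == 2 * m then 0 else i.+1)./2 = s i./2.
    rewrite sE; last by lia.
    by case: (i.+1 =P 2 * m) => ?; case: (i./2.+1 =P m) => ?; lia.
  by rewrite e2 orbT.
have -> : (i.+1 == 2 * m) = false by lia.
rewrite [odd _]/= oi /=; have -> : uphalf i = i./2 by lia.
by rewrite e1.
Qed.

(** Since [A :|: B] fits in [S], the intersection has at least [k - 1] points, and distinctness
    allows no more. This turns two edges of [F] at [S] into a link edge over [A :&: B]. *)
Lemma subset_pair_split (k : nat) A B S : A != B -> A \subset S -> B \subset S ->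
  #|A| = k -> #|B| = k -> #|S| = k.+1 ->
  exists a b, let T := A :&: B in
    [/\ #|T| = k.-1, a \notin T, b \notin T & a != b] /\
    [/\ A = a |: T, B = b |: T & S = a |: (b |: T)].
Proof.
move=> AB AS BS cA cB cS.
have nsub (X Y : {set 'I_n}) : #|X| = #|Y| -> X != Y -> exists2 a, a \in X & a \notin Y.
  move=> cXY neq; apply/subsetPn; apply: contra neq => sub.
  by rewrite eqEcard sub cXY leqnn.
have [a aA aB] := nsub A B (etrans cA (esym cB)) AB.
have [b bB bA] : exists2 b, b \in B & b \notin A by apply: nsub; rewrite ?cA // eq_sym.
exists a, b => /=; set T := A :&: B.
have aT : a \notin T by rewrite inE (negPf aB) andbF.
have bT : b \notin T by rewrite inE (negPf bA).
have ab : a != b by apply: contraNneq aB => ->.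
have cT : k.-1 <= #|T|.
  have := cardsUI A B; rewrite -/T; have : #|A :|: B| <= k.+1.
    by rewrite -cS subset_leq_card // subUset AS.
  by rewrite cA cB; clear; lia.
have sA : a |: T \subset A by rewrite subUset sub1set aA subsetIl.
have sB : b |: T \subset B by rewrite subUset sub1set bB subsetIr.
have k_gt0 : 0 < k by rewrite -cA; apply/card_gt0P; exists a.
have cT' : #|T| = k.-1.
  apply/eqP; rewrite eqn_leq cT andbT -ltnS prednK //.
  by have := subset_leq_card sA; rewrite cardsU1 aT cA.
split; first by [].
split; apply/esym/eqP; rewrite eqEcard ?sA ?sB /=.
- by rewrite cardsU1 aT cA cT' add1n prednK.
- by rewrite cardsU1 bT cB cT' add1n prednK.
- rewrite subUset sub1set (subsetP AS) // (subset_trans sB) //=.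
  by rewrite !cardsU1 bT inE !inE (negPf ab) (negPf aB) andbF /= cS cT' !add1n prednK.
Qed.

(** A squared degree counts ordered pairs of edges at [S]. Equal pairs contribute [#|F|] in total;
    each distinct pair (the set [W]) comes from an ordered link edge (the set [L]). *)
Lemma sum_sqr_degree F k : F \subset Jedges n k ->
  \sum_S #|[set A | (A, S) \in F]| ^ 2
  <= #|F| + \sum_(T : {set 'I_n} | #|T| == k.-1) #|edges (link F T)|.
Proof.
move=> FJ.
pose W : {set {set 'I_n} * ({set 'I_n} * {set 'I_n})} :=
  [set w | [&& (w.2.1, w.1) \in F, (w.2.2, w.1) \in F & w.2.1 != w.2.2]].
pose L : {set {set 'I_n} * ('I_n * 'I_n)} :=
  [set w : {set 'I_n} * ('I_n * 'I_n) | (#|w.1| == k.-1) && link F w.1 w.2.1 w.2.2].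
have WL : #|W| <= #|L|.
  pose g (w : {set 'I_n} * ('I_n * 'I_n)) :=
    let: (T, (a, b)) := w in (a |: (b |: T), (a |: T, b |: T)).
  apply: leq_trans (leq_imset_card g L); apply: subset_leq_card.
  apply/subsetP => -[S [A B]]; rewrite inE /= => /and3P[AS BS AB].
  have := subsetP FJ _ AS; have := subsetP FJ _ BS; rewrite !inE /=.
  move=> /and3P[/eqP cB _ sB] /and3P[/eqP cA /eqP cS sA].
  have [a [b /= [[cT aT bT ab] [EA EB ES]]]] := subset_pair_split AB sA sB cA cB cS.
  apply/imsetP; exists (A :&: B, (a, b)); last by rewrite /= -ES -EA -EB.
  rewrite inE [X in X && _]/= cT eqxx.
  by apply/and5P; split; rewrite //= -ES -EA -EB AS.
have cL : #|L| = \sum_(T : {set 'I_n} | #|T| == k.-1) #|edges (link F T)|.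
  rewrite card_setX_sum1 [RHS]big_mkcond; apply: eq_bigr => T _.
  case: ifP => cT; first by apply: eq_card => -[a b]; rewrite !inE /= cT.
  by apply: eq_card0 => -[a b]; rewrite !inE /= cT.
rewrite -cL; apply: leq_trans (_ : #|F| + #|W| <= _); last by rewrite leq_add2l.
rewrite (card_setX_sum2 F) (card_setX_sum1 W) -big_split /=.
apply: leq_sum => S _; set N := [set A | _].
rewrite -mulnn -cardsX.
apply: leq_trans (leq_add (leq_imset_card (fun A => (A, A)) N) (leqnn _)).
apply: leq_trans (leq_card_setU _ _); apply: subset_leq_card.
apply/subsetP => -[A B]; rewrite in_setX in_setU => /andP[AN BN].
have [<-|AB] := eqVneq A B; first by rewrite imset_f.
by apply/orP; right; move: AN BN; rewrite !inE /= AB andbT => -> ->.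
Qed.

End Link.

(** * Cardinality bounds for [F] and for its links *)

Lemma eJE n k : eJ n k = k.+1 * 'C(n, k.+1).
Proof.
rewrite /eJ card_setX_sum2 -[n in RHS]card_ord -card_draws mulnC -sum_nat_const.
rewrite [RHS]big_mkcond; apply: eq_bigr => S _; rewrite inE.
case: ifP => cS; last by apply: eq_card0 => A; rewrite !inE /= cS andbF.
have <- : #|[set A : {set 'I_n} | A \subset S & #|A| == k]| = k.+1.
  by rewrite cards_draws (eqP cS) -bin_sub // subSnn bin1.
by apply: eq_card => A; rewrite !inE /= cS andbC.
Qed.

(** The fraction [a / b] is the density [p], taken relative to [(n - k) ^ 2] to match the binomial
    identities. *)
Lemma card_sqr_bound n k a b (F : {set {set 'I_n} * {set 'I_n}}) :
  0 < k -> F \subset Jedges n k ->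
  (forall T, b * #|edges (link F T)| <= a * (n - k) ^ 2) ->
  b * #|F| ^ 2 <= b * 'C(n, k.+1) * #|F| + a * k * k.+1 * 'C(n, k.+1) ^ 2.
Proof.
move=> k_gt0 FJ bound; set N := 'C(n, k.+1).
pose P := [set S : {set 'I_n} | #|S| == k.+1].
have cP : #|P| = N by rewrite card_draws card_ord.
pose d (S : {set 'I_n}) := #|[set A | (A, S) \in F]|.
have d0 S : S \notin P -> d S = 0.
  move=> SP; apply: eq_card0 => A; rewrite inE; apply: contraNF SP => /(subsetP FJ).
  by rewrite !inE => /and3P[].
have cF : #|F| = \sum_(S in P) d S.
  rewrite card_setX_sum2 [RHS]big_mkcond; apply: eq_bigr => S _.
  by case: ifPn => // /d0.
have CS := sqr_sum_leq P d; rewrite -cF cP in CS.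
have le1 : \sum_(S in P) d S ^ 2 <= \sum_S d S ^ 2.
  by rewrite big_mkcond; apply: leq_sum => S _; case: ifP.
have le2 := sum_sqr_degree FJ.
set Sig := (X in _ <= _ + X) in le2.
have le3 : b * Sig <= 'C(n, k.-1) * (a * (n - k) ^ 2).
  rewrite big_distrr /=; apply: leq_trans (leq_sum _ (fun T _ => bound T)) _.
  by rewrite sum_nat_cond_const -[n in 'C(n, _)]card_ord -card_draws.
(* Two absorption identities give [k (k+1) N = (n - k) (n - k + 1) C(n, k-1)]. *)
have binE : 'C(n, k.-1) * (n - k) ^ 2 <= k * k.+1 * N.
  have E1 := mul_bin_left n k; have := mul_bin_left n k.-1; rewrite prednK // => E2.
  rewrite -mulnA E1 mulnCA E2 -mulnn mulnC -mulnA.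
  by rewrite !leq_mul // leq_sub2l // leq_pred.
have {CS le1 le2} CS : #|F| ^ 2 <= N * (#|F| + Sig).
  by apply: leq_trans CS _; rewrite leq_mul2l (leq_trans le1 le2) orbT.
apply: leq_trans (leq_mul (leqnn b) CS) _.
rewrite mulnCA mulnDr mulnDr mulnA (mulnC N b) leq_add2l.
apply: leq_trans (leq_mul (leqnn N) le3) _.
apply: leq_trans (_ : N * (a * (k * k.+1 * N)) <= _); last by lia.
by rewrite leq_mul // mulnCA leq_mul.
Qed.

(** Density [1 / (4 k)] is small enough for the final quadratic inequality. From [n <= 2 (n - k)]
    one loses a factor 4, hence the parameter [16 * k]. *)
Lemma even_link_bound k l : 0 < k -> 1 < l -> exists n0, forall n, n0 <= n ->
  2 * k + 1 <= n -> forall F : {set {set 'I_n} * {set 'I_n}},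
  ~~ has_cycle F (4 * l) ->
  forall T, 4 * k * #|edges (link F T)| <= 1 * (n - k) ^ 2.
Proof.
move=> k_gt0 l_gt1; exists (4 * (16 * k) * l * (2 ^ (4 * (16 * k) * l)).+1).
move=> n n_big nk F noC T; rewrite leqNgt; apply: contra noC => E_big.
have -> : 4 * l = 2 * (2 * l) by rewrite mulnA.
apply: (@link_cycle _ _ T); first by lia.
apply: (@dense_even_cycle _ _ (@link_sym _ F T) (@link_irr _ F T) l (16 * k));
  rewrite ?card_ord //; try lia.
have : n ^ 2 <= (2 * (n - k)) ^ 2 by rewrite leq_sqr; lia.
by rewrite expnMn; move: E_big; clear; lia.
Qed.

(** With [D = 4 k] the bound is [(D + 2) / (2 D)] relative to [(n - k) ^ 2], while [dense_cycle]
    needs only [(D + 1) / (2 D)] relative to [n ^ 2]; for large [n] the gap absorbs the change of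
    scale. *)
Lemma odd_link_bound k l : 0 < k -> 0 < l -> exists n0, forall n, n0 <= n ->
  forall F : {set {set 'I_n} * {set 'I_n}}, ~~ has_cycle F (4 * l + 2) ->
  forall T, 4 * k * #|edges (link F T)| <= (2 * k + 1) * (n - k) ^ 2.
Proof.
move=> k_gt0 l_gt0; pose m := 2 * l + 1; pose D := 4 * k.
exists (2 * D * (2 * D * m + D + 1) + k * (3 * D + 4)).
move=> n n_big F noC T; rewrite leqNgt; apply: contra noC => E_big.
have -> : 4 * l + 2 = 2 * m by rewrite /m; lia.
apply: (@link_cycle _ _ T); first by rewrite /m; lia.
apply: (@dense_cycle _ _ (@link_sym _ F T) (@link_irr _ F T) m D);
  rewrite ?card_ord //; try (rewrite /m /D; lia).
(* The rational [D + 4/3] lies below the geometric mean of [D + 1] and [D + 2], which avoids square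
   roots. *)
have n_k : 3 * (D + 1) * n <= (3 * D + 4) * (n - k).
  rewrite mulnBr; move: n_big; clear; lia.
have : (3 * (D + 1) * n) ^ 2 <= ((3 * D + 4) * (n - k)) ^ 2 by rewrite leq_sqr.
rewrite !expnMn.
have : (3 * D + 4) ^ 2 <= 9 * ((D + 1) * (D + 2)) by clear; lia.
move/(leq_mul)/(_ (leqnn ((n - k) ^ 2)))=> H1 H2.
have {H1 H2} : 9 * (D + 1) * ((D + 1) * n ^ 2) <= 9 * (D + 1) * ((D + 2) * (n - k) ^ 2).
  by move: (leq_trans H2 H1); clear; lia.
rewrite leq_pmul2l; last by lia.
by move: E_big; rewrite /D; clear; lia.
Qed.

(** * Real inequalities and the two constants *)

Lemma INR_exJ_le n k m (B : R) : (0 <= B)%R ->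
  (forall F : {set {set 'I_n} * {set 'I_n}}, F \subset Jedges n k ->
     ~~ has_cycle F m -> (INR #|F| <= B)%R) ->
  (INR (exJ n k m) <= B)%R.
Proof.
move=> B_ge0 bound; rewrite /exJ.
apply: (big_ind (fun x => (INR x <= B)%R)) => //.
  by move=> x y xB yB; rewrite /maxn; case: ifP.
by move=> F /andP[FJ noC]; apply: bound.
Qed.

Lemma exJ_leq_eJ n k m : exJ n k m <= eJ n k.
Proof. by apply/bigmax_leqP => F /andP[/subset_leq_card]. Qed.

(** For [x > N t >= N], monotonicity of [x (x - N)] gives a value above [(t^2 - t) N^2]. *)
Lemma le_of_quadratic (x N t q : R) : (0 <= N)%R -> (1 <= t)%R ->
  (q <= t * t - t)%R -> (x * x <= N * x + q * (N * N))%R -> (x <= N * t)%R.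
Proof.
move=> N_ge0 t_ge1 qt xq; apply: Rnot_lt_le => Ntx.
have N_le : (N <= N * t)%R by nra.
have : (q * (N * N) <= (t * t - t) * (N * N))%R by apply: Rmult_le_compat_r => //; nra.
have : (N * t * (x - N) < x * (x - N))%R by apply: Rmult_lt_compat_r; lra.
have : (N * t * (N * t - N) <= N * t * (x - N))%R by apply: Rmult_le_compat_l; nra.
lra.
Qed.

(** Here [t] bounds the average degree in [F] of a [(k+1)]-set, whose degree in the full graph is
    [k + 1]. *)
Lemma INR_card_bound n k a b (t : R) (F : {set {set 'I_n} * {set 'I_n}}) :
  0 < k -> 0 < b -> F \subset Jedges n k ->
  (forall T, b * #|edges (link F T)| <= a * (n - k) ^ 2) ->
  (1 <= t)%R -> (INR a * INR k * (INR k + 1) <= INR b * (t * t - t))%R ->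
  (INR #|F| <= t / (INR k + 1) * INR (eJ n k))%R.
Proof.
move=> k_gt0 b_gt0 FJ bound t_ge1 ht.
have bR : (0 < INR b)%R by apply: lt_0_INR; lia.
have kR : (0 <= INR k)%R by apply: pos_INR.
have H := card_sqr_bound k_gt0 FJ bound.
have -> : (t / (INR k + 1) * INR (eJ n k) = INR 'C(n, k.+1) * t)%R.
  by rewrite eJE mult_INR S_INR; field; lra.
apply: (@le_of_quadratic _ _ t (INR a * INR k * (INR k + 1) / INR b)) => //.
- exact: pos_INR.
- apply: (Rmult_le_reg_l (INR b)) => //; apply: Rle_trans ht.
  by apply: Req_le; field; lra.
move/leP/le_INR: H; rewrite -!mulnn -!plusE -!multE.
rewrite plus_INR !mult_INR S_INR => H.
apply: (Rmult_le_reg_l (INR b)) => //; apply: Rle_trans H _.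
by apply: Req_le; field; lra.
Qed.

Theorem theorem1p1 (k l : nat) (hk : (0 < k)%N) (hl : (0 < l)%N) :
  ((2 <= l)%N ->
    exists c : R, forall n : nat, (2 * k + 1 <= n)%N ->
      (INR (exJ n k (4 * l)) <=
        (c * Rpower (INR (n - k)) (- (1 / 2) + 1 / (2 * INR l))
          + 1 / sqrt (INR (k + 1))) * INR (eJ n k))%R)
  /\
  (exists f : nat -> R, Un_cv f 0%R /\
    forall n : nat, (2 * k + 1 <= n)%N ->
      (INR (exJ n k (4 * l + 2)) <=
        (1 / (2 * INR (k + 1)) + sqrt 2 / 2 + f n) * INR (eJ n k))%R).
Proof.
have kR : (1 <= INR k)%R by apply: (le_INR 1); lia.
have kE : INR (k + 1) = (INR k + 1)%R by rewrite addn1 S_INR.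
split=> [l_ge2|].
  have [n0 Hn0] := even_link_bound hk l_ge2.
  have lR : (2 <= INR l)%R by apply: (le_INR 2); lia.
  set al := (- (1 / 2) + 1 / (2 * INR l))%R.
  have al_le0 : (al <= 0)%R.
    rewrite /al; have : (1 / (2 * INR l) <= 1 / 2)%R; last by lra.
    by apply: Rmult_le_compat_l; [lra|apply: Rinv_le_contravar; lra].
  (* As [al <= 0], this constant makes the error term at least 1 for [n < n0], where the trivial
     bound suffices. *)
  exists (Rpower (INR n0 + 1) (- al)) => n n_ge.
  set s := sqrt (INR (k + 1)).
  have ss : (s * s = INR k + 1)%R by rewrite /s kE sqrt_sqrt; lra.
  (* The threshold 4/3 is exactly where [s^2 <= 4 (s^2 - s)], the inequality required by [t = s] and
     density [1 / (4 k)]. *)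
  have s_gt : (4 / 3 <= s)%R.
    by rewrite -(sqrt_square (4 / 3)); [apply: sqrt_le_1_alt; rewrite kE; lra|lra].
  have c_ge0 : (0 < Rpower (INR n0 + 1) (- al) * Rpower (INR (n - k)) al)%R.
    by apply: Rmult_lt_0_compat; apply: exp_pos.
  have e_ge0 := pos_INR (eJ n k).
  have s_inv : (0 < 1 / s)%R by apply: Rdiv_lt_0_compat; lra.
  have [n_big|n_small] := leqP n0 n.
    apply: INR_exJ_le => [|F FJ noC]; first by nra.
    apply: (@Rle_trans _ (s / (INR k + 1) * INR (eJ n k))).
      apply: (INR_card_bound hk _ FJ (Hn0 n n_big n_ge F noC)); [lia|lra|].
      have : (INR k * (s * s) <= INR k * (4 * (s * s - s)))%R.
        by apply: Rmult_le_compat_l; nra.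
      by rewrite -ss -multE mult_INR /=; lra.
    apply: Rmult_le_compat_r => //.
    have -> : (s / (INR k + 1) = 1 / s)%R by rewrite -ss; field; lra.
    lra.
  have : (INR (exJ n k (4 * l)) <= INR (eJ n k))%R by apply/le_INR/leP/exJ_leq_eJ.
  suff : (1 <= Rpower (INR n0 + 1) (- al) * Rpower (INR (n - k)) al)%R by nra.
  have nk_gt0 : (0 < INR (n - k))%R by apply: lt_0_INR; lia.
  have nk_le : (INR (n - k) <= INR n0 + 1)%R.
    by rewrite -S_INR; apply: le_INR; lia.
  rewrite -{1}exp_0 /Rpower -exp_plus.
  have lnle : (ln (INR (n - k)) <= ln (INR n0 + 1))%R.
    by case: nk_le => [H|->]; [left; apply: ln_increasing|right].
  have : (0 <= - al * ln (INR n0 + 1) + al * ln (INR (n - k)))%R by nra.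
  by case=> [/exp_increasing|<-]; lra.
have [n0 Hn0] := odd_link_bound hk hl.
exists (fun n => if n0 <= n then 0%R else 1%R); split.
  move=> eps eps_gt0; exists n0 => n /leP ->.
  by rewrite R_dist_eq.
move=> n _.
have e_ge0 := pos_INR (eJ n k).
have s2 : (sqrt 2 * sqrt 2 = 2)%R by rewrite sqrt_sqrt; lra.
have s2_ge : (1 <= sqrt 2)%R by rewrite -{1}sqrt_1; apply: sqrt_le_1_alt; lra.
have k_inv : (0 < 1 / (2 * INR (k + 1)))%R by apply: Rdiv_lt_0_compat; lra.
have [n_big|n_small] := leqP n0 n; last first.
  have : (INR (exJ n k (4 * l + 2)) <= INR (eJ n k))%R by apply/le_INR/leP/exJ_leq_eJ.
  nra.
apply: INR_exJ_le => [|F FJ noC]; first by nra.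
(* Chosen so that [(t - 1/2)^2 = (k+1)^2 / 2]; the inequality to check reduces to
   [(k+1) / 4 >= 1/4]. *)
pose t := (1 / 2 + (INR k + 1) * (sqrt 2 / 2))%R.
have -> : (1 / (2 * INR (k + 1)) + sqrt 2 / 2 + 0 = t / (INR k + 1))%R.
  by rewrite kE /t; field; lra.
apply: (INR_card_bound hk _ FJ (Hn0 n n_big F noC)); first by lia.
  by rewrite /t; nra.
have -> : (t * t - t = (INR k + 1) * (INR k + 1) / 2 - 1 / 4)%R.
  by rewrite /t; nra.
rewrite -!multE -plusE plus_INR !mult_INR /=; nra.
Qed.
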